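(* Let $a,b\in\mathbb R$ be such that $a<b$, and let $\ell,n,r\in\overline{\mathbb N}_0$ be such that $\ell,r\le n$. Let $\sigma\in\Sigma_{\ell,r}$, and set $\mathcal{B}_{L}(f):=(\sigma\circ\lambda)\cdot f$ for $f\in C^{n}[a,b]$, where $\lambda(x):=(x-a)/(b-a)$ for $a\le x\le b$. Then $\mathcal{B}_{L}$ is a linear leftward blend-to-zero operator on $C^n[a,b]$ of orders $\ell$ and $r$.
   Context: $\overline{\mathbb N}_0=\{0,1,2,\dots\}\cup\{\infty\}$. When an order equals $\infty$, the corresponding conditions are understood to hold for every finite derivative order. $C^n[a,b]$ denotes the real-valued $n$-times continuously differentiable functions on $[a,b]$ (one-sided derivatives at endpoints). $\Sigma_{\ell,r}$ is the family of smooth step functions of orders $\ell$ and $r$: strictly increasing functions $\sigma:[0,1]\to[0,1]$, $\sigma\in C^\infty[0,1]$, with $\sigma(0)=0$, $\sigma(1)=1$, $\sigma^{(j)}(0)=0$ for $j=1,\dots,\ell$ and $\sigma^{(k)}(1)=0$ for $k=1,\dots,r$ (a condition of order $0$ being vacuous). An operator $\mathcal{B}:C^{n}[a,b]\to C^{n}[a,b]$ is a leftward blend-to-zero operator of orders $\ell$ and $r$ (with $\ell,r\le n$) if for all $g\in C^{n}[a,b]$ the function $g_0=\mathcal{B}(g)$ satisfies $g_0^{(j)}(a)=0$ for $j=0,\dots,\ell$ and $g_0^{(k)}(b)=g^{(k)}(b)$ for $k=0,\dots,r$. *)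

(* Defs.v *)
From mathcomp Require Import all_boot all_order all_algebra.
From mathcomp Require Import all_classical all_reals all_analysis.

Set Implicit Arguments.
Unset Strict Implicit.
Unset Printing Implicit Defensive.
Import Order.TTheory GRing.Theory Num.Theory.
Import numFieldNormedType.Exports.
Local Open Scope classical_set_scope.
Local Open Scope ring_scope.

(* {0, 1, 2, ...} together with infinity, the latter being encoded as None. *)
Definition enat := option nat.

(* A condition of order n is imposed for the finite orders j with fin_le j n,
   hence for all of them when n is infinite. *)
Definition fin_le (j : nat) (n : enat) : bool :=
  if n is Some m then (j <= m)%N else true.

Definition enat_le (m n : enat) : bool :=
  if m is Some j then fin_le j n else n == None.

(* A real function on [a, b] is represented by a function R -> R whose values
   outside [a, b] are irrelevant: limits, derivatives and continuity below only
   involve points of [a, b], and equality is equality on [a, b]. *)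
Section Smooth_functions_on_a_segment.
Variables (R : realType) (a b : R).
Implicit Types (f g : R -> R) (x : R) (n l r : enat).

(* At x = a and x = b the limit is automatically the one-sided one. *)
Definition slope f x : R -> R := fun y => (f y - f x) / (y - x).

Definition derivable_on f :=
  {in `[a, b], forall x,
    cvg (slope f x y @[y --> within `[a, b]%classic x^'])}.

Definition deriv_on f : R -> R :=
  fun x => lim (slope f x y @[y --> within `[a, b]%classic x^']).

Definition nderiv_on (j : nat) f : R -> R := iter j deriv_on f.

Definition Cn n f :=
  (forall i : nat, fin_le i.+1 n -> derivable_on (nderiv_on i f)) /\
  (forall j : nat, fin_le j n -> {within `[a, b], continuous (nderiv_on j f)}).

(* The second clause says that B f depends only on the restriction of f to
   [a, b], so that B is a well-defined map C^n[a, b] -> C^n[a, b]. *)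
Definition operator_on_Cn n (B : (R -> R) -> (R -> R)) :=
  (forall f, Cn n f -> Cn n (B f)) /\
  (forall f g, Cn n f -> Cn n g ->
    {in `[a, b], f =1 g} -> {in `[a, b], B f =1 B g}).

Definition linear_on_Cn n (B : (R -> R) -> (R -> R)) :=
  forall (c : R) f g, Cn n f -> Cn n g ->
    {in `[a, b], forall x, B (fun y => c * f y + g y) x = c * B f x + B g x}.

Definition leftward_blend_to_zero n l r (B : (R -> R) -> (R -> R)) :=
  [/\ enat_le l n, enat_le r n, operator_on_Cn n B &
      forall g, Cn n g ->
        (forall j : nat, fin_le j l -> nderiv_on j (B g) a = 0) /\
        (forall k : nat, fin_le k r ->
          nderiv_on k (B g) b = nderiv_on k g b)].

End Smooth_functions_on_a_segment.

Definition smooth_step (R : realType) (l r : enat) (sigma : R -> R) :=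
  [/\ set_fun `[0, 1]%classic `[0, 1]%classic sigma,
      {in `[0, 1] &, {homo sigma : x y / x < y}} &
      Cn 0 1 None sigma] /\
  [/\ sigma 0 = 0, sigma 1 = 1,
      forall j : nat, (1 <= j)%N -> fin_le j l -> nderiv_on 0 1 j sigma 0 = 0 &
      forall k : nat, (1 <= k)%N -> fin_le k r -> nderiv_on 0 1 k sigma 1 = 0].

Definition to_unit (R : realType) (a b : R) : R -> R :=
  fun x => (x - a) / (b - a).

Definition blend_left (R : realType) (a b : R) (sigma f : R -> R) : R -> R :=
  (sigma \o to_unit a b) \* f.

(* Main.v *)
Require Import Defs.
From mathcomp Require Import all_boot all_order all_algebra.
From mathcomp Require Import all_classical all_reals all_analysis.
From mathcomp Require Import ring.
Import Order.TTheory GRing.Theory Num.Theory.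
Import numFieldNormedType.Exports.
Local Open Scope classical_set_scope.
Local Open Scope ring_scope.

(** Put s := sigma o lambda. Since lambda is affine with slope 1 / (b - a), the
    j-th derivative of s at x is that of sigma at lambda x, divided by
    (b - a) ^ j ([nderiv_on_to_unit]). So s is smooth on [a, b], it vanishes at a
    together with its derivatives up to order l, and s - 1 vanishes at b together
    with its derivatives up to order r.

    Products of C^n functions are C^n ([Cn_mul]), so f |-> s * f maps C^n[a, b]
    to itself; its linearity is pointwise. The boundary conditions follow from one
    fact, proved by induction on j: if a function vanishes to order j at a point,
    then so does its product with any C^j function ([nderiv_on_mul_flat]). At a this applies to s * g. At b it applies to the
    first term of s * g = (s - 1) * g + g, which leaves the derivatives of g.

    The iterated derivative is only meaningful on [a, b], where all identities
    between derivatives hold; they are pushed under further derivatives because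
    the derivative on [a, b] depends only on the values there
    ([nderiv_on_ext]). Sums and scalar multiples are handled together, as
    combinations c * f + g. *)

(** * Difference quotients on a segment *)

Section Derivatives_on_a_segment.
Set Implicit Arguments.
Context {R : realType} {a b : R}.
Implicit Types (f g : R -> R) (x d e c : R).

Local Notation punctured x := (within `[a, b]%classic x^').
Local Notation D := (deriv_on a b).

(** The relational form of the derivative: calculus rules for it need no
    differentiability hypothesis besides the limits that they combine. *)
Definition has_deriv f x d := slope f x y @[y --> punctured x] --> d.

Hypothesis ab : a < b.

(** Makes limits of difference quotients unique. As a < b, every point of the
    segment is approached from the right inside it, or else is b and is
    approached from the left. *)
Lemma punctured_proper x : x \in `[a, b] -> ProperFilter (punctured x).
Proof.
rewrite in_itv /= => /andP[ax xb].
apply: Build_ProperFilter_ex => P.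
rewrite /within /= => P'.
have [xltb|blex] := ltP x b.
- have : \forall y \near x^'+, P y.
    near=> y.
    have y_gt : x < y by near: y; exact: nbhs_right_gt.
    suff : y \in `[a, b] -> P y.
      apply; rewrite in_itv /= (le_trans ax (ltW y_gt)) /=.
      by near: y; exact: nbhs_right_le.
    move: (y_gt); near: y; move: P'.
    rewrite /dnbhs /at_right !near_withinE.
    apply: filterS => y Py xy _.
    move=> yab; apply: Py => //.
    by rewrite gt_eqF.
  exact: (@filter_ex _ (at_right x)).
have altx : a < x by exact: lt_le_trans blex.
have : \forall y \near x^'-, P y.
  near=> y.
  have y_lt : y < x by near: y; exact: nbhs_left_lt.
  suff : y \in `[a, b] -> P y.
    apply; rewrite in_itv /= (le_trans (ltW y_lt) xb) andbT.
    by near: y; exact: nbhs_left_ge.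
  move: (y_lt); near: y; move: P'.
  rewrite /dnbhs /at_left !near_withinE.
  apply: filterS => y Py xy _ yab; apply: Py => //.
  by rewrite lt_eqF.
exact: (@filter_ex _ (at_left x)).
Unshelve. all: by end_near. Qed.

Lemma near_punctured (P : set R) x :
  (forall y, y \in `[a, b] -> y != x -> P y) -> \forall y \near punctured x, P y.
Proof.
move=> HP; rewrite /dnbhs !near_withinE.
by apply: nearW => y yx yab; exact: HP.
Qed.

Lemma has_deriv_D f x d : x \in `[a, b] -> has_deriv f x d -> D f x = d.
Proof.
by move=> /punctured_proper ? fd; apply: cvg_lim fd.
Qed.

Lemma derivable_onP f :
  derivable_on a b f <-> {in `[a, b], forall x, has_deriv f x (D f x)}.
Proof.
split=> [df x xab|df x xab]; first exact: df.
by apply/cvg_ex; exists (D f x); exact: df.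
Qed.

Lemma has_deriv_derivable f (f' : R -> R) :
  {in `[a, b], forall x, has_deriv f x (f' x)} ->
  derivable_on a b f /\ {in `[a, b], D f =1 f'}.
Proof.
move=> df; split=> x xab; first by apply/cvg_ex; exists (f' x); exact: df.
exact: has_deriv_D (df x xab).
Qed.

Lemma has_deriv_ext f g x d :
  x \in `[a, b] -> {in `[a, b], f =1 g} -> has_deriv f x d -> has_deriv g x d.
Proof.
move=> xab fg; apply: cvg_trans; apply: near_eq_cvg.
by apply: near_punctured => y yab yx; rewrite /slope !fg.
Qed.

Lemma has_deriv_cst c x : has_deriv (cst c) x 0.
Proof.
rewrite /has_deriv /slope; apply: cvg_near_cst.
by apply: near_punctured => y _ _; rewrite /cst subrr mul0r.
Qed.

Lemma has_deriv_lin c f g x d e :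
  has_deriv f x d -> has_deriv g x e ->
  has_deriv (fun y => c * f y + g y) x (c * d + e).
Proof.
move=> fd ge; rewrite /has_deriv.
rewrite (_ : slope _ x = fun y => c * slope f x y + slope g x y).
  by apply: cvgD ge; apply: cvgM fd; exact: cvg_cst.
by apply/funext => y; rewrite /slope; ring.
Qed.

(** For y other than x, f y is the difference quotient times y - x, plus f x. *)
Lemma has_deriv_continuous f x d :
  has_deriv f x d -> f y @[y --> punctured x] --> f x.
Proof.
move=> fd.
have idx : (y - x) @[y --> punctured x] --> (0 : R).
  rewrite -(subrr x); apply: cvgB; last exact: cvg_cst.
  by apply: cvg_within_filter; apply: cvg_within_filter; exact: cvg_id.
have : slope f x y * (y - x) + f x @[y --> punctured x] --> f x.
  rewrite -[X in _ --> X]add0r -(mulr0 d).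
  by apply: cvgD; [exact: cvgM fd idx|exact: cvg_cst].
apply: cvg_trans; apply: near_eq_cvg.
apply: near_punctured => y _ yx /=.
by rewrite /slope /= divfK ?subrK // subr_eq0.
Qed.

(** The continuity of f at x enters because the difference quotient of the
    product splits as that of f times g x, plus f y times that of g. *)
Lemma has_deriv_mul f g x d e :
  has_deriv f x d -> has_deriv g x e ->
  has_deriv (f \* g) x (d * g x + f x * e).
Proof.
move=> fd ge; rewrite /has_deriv.
rewrite (_ : slope _ x = fun y => slope f x y * g x + f y * slope g x y).
  apply: cvgD; first by apply: (cvgM fd); exact: cvg_cst.
  by apply: cvgM ge; exact: has_deriv_continuous fd.
by apply/funext => y; rewrite /slope /=; ring.
Qed.

(** * The classes of n times continuously differentiable functions *)

Lemma deriv_on_ext f g : {in `[a, b], f =1 g} -> {in `[a, b], D f =1 D g}.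
Proof.
move=> fg x xab; rewrite /deriv_on; congr (lim _); apply/seteqP.
by split; apply: near_eq_cvg; apply: near_punctured => y yab _;
  rewrite /slope !fg.
Qed.

Local Notation cont f := {within `[a, b], continuous f}.

Lemma nderiv_onSr j f : nderiv_on a b j.+1 f = nderiv_on a b j (D f).
Proof. exact: iterSr. Qed.

Lemma nderiv_on_ext j f g :
  {in `[a, b], f =1 g} -> {in `[a, b], nderiv_on a b j f =1 nderiv_on a b j g}.
Proof. by move=> fg; elim: j => //= j; exact: deriv_on_ext. Qed.

Lemma cont_ext f g : {in `[a, b], f =1 g} -> cont f -> cont g.
Proof.
move=> fg; apply: subspace_eq_continuous => x; rewrite inE => xab.
exact: fg.
Qed.

Lemma fin_le_trans j m n : (j <= m)%N -> fin_le m n -> fin_le j n.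
Proof. by case: n => //= n; exact: leq_trans. Qed.

(** Reduces statements about a possibly infinite order to finite orders, where
    induction on the order is available. *)
Lemma Cn_finite n f :
  Cn a b n f <-> forall m, fin_le m n -> Cn a b (Some m) f.
Proof.
split=> [[df cf] m mn|C].
  by split=> i im; [apply: df|apply: cf]; exact: fin_le_trans im mn.
by split=> i im; have [df cf] := C _ im; [apply: df|apply: cf] => /=.
Qed.

Lemma Cn0 f : Cn a b (Some 0) f <-> cont f.
Proof. by split=> [[_ /(_ 0)]|cf]; [exact|split=> // -[]]. Qed.

(** Peels off the innermost derivative, so that inductions on the order can
    replace f by its derivative. *)
Lemma CnS m f : Cn a b (Some m.+1) f <->
  [/\ derivable_on a b f, cont f & Cn a b (Some m) (D f)].
Proof.
split=> [[df cf]|[df cf [ddf cdf]]].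
  split; [exact: (df 0)|exact: (cf 0)|].
  by split=> i im; rewrite -nderiv_onSr; [exact: df|exact: cf].
by split=> -[|i] // im; rewrite nderiv_onSr; [exact: ddf|exact: cdf].
Qed.

Lemma Cn_pred m f : Cn a b (Some m.+1) f -> Cn a b (Some m) f.
Proof. by move=> /Cn_finite; apply=> /=. Qed.

Lemma Cn_ext n f g : {in `[a, b], f =1 g} -> Cn a b n f -> Cn a b n g.
Proof.
move=> fg [df cf]; split=> i im; last first.
  exact: cont_ext (nderiv_on_ext i fg) (cf _ im).
have /derivable_onP dif := df _ im.
have [] // := @has_deriv_derivable (nderiv_on a b i g) (D (nderiv_on a b i f)).
by move=> x xab; apply: has_deriv_ext (dif _ xab) => //; exact: nderiv_on_ext.
Qed.

(** The usual way to establish regularity: it suffices to exhibit a derivative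
    of class C^m, which need not agree with the derivative outside [a, b]. *)
Lemma CnS_has_deriv m f (f' : R -> R) :
  {in `[a, b], forall x, has_deriv f x (f' x)} -> cont f ->
  Cn a b (Some m) f' -> Cn a b (Some m.+1) f.
Proof.
move=> /has_deriv_derivable[df Df] cf Cf'; apply/CnS; split=> //.
by apply: Cn_ext Cf' => x /Df.
Qed.

Lemma cont_lin c f g : cont f -> cont g -> cont (fun x => c * f x + g x).
Proof.
move=> cf cg x; apply: cvgD (cg x).
by apply: cvgM (cf x); exact: cvg_cst.
Qed.

Lemma cont_mul f g : cont f -> cont g -> cont (f \* g).
Proof. by move=> cf cg x; exact: cvgM (cf x) (cg x). Qed.

Lemma Cn_cst m c : Cn a b (Some m) (cst c).
Proof.
elim: m c => [|m IH] c; first by apply/Cn0 => x; exact: cvg_cst.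
apply: (@CnS_has_deriv _ _ (cst 0)) (IH 0) => [x _|x]; last exact: cvg_cst.
exact: has_deriv_cst.
Qed.

Lemma Cn_lin m c f g : Cn a b (Some m) f -> Cn a b (Some m) g ->
  Cn a b (Some m) (fun x => c * f x + g x).
Proof.
elim: m f g => [|m IH] f g; first by rewrite !Cn0; exact: cont_lin.
move=> /CnS[/derivable_onP df cf Cf] /CnS[/derivable_onP dg cg Cg].
apply: CnS_has_deriv (IH _ _ Cf Cg); last exact: cont_lin.
by move=> x xab; apply: has_deriv_lin; [exact: df|exact: dg].
Qed.

(** The factor 1 gives the right-hand side the form c * u + v of
    [nderiv_on_lin]. *)
Lemma deriv_on_mul f g : derivable_on a b f -> derivable_on a b g ->
  {in `[a, b], D (f \* g) =1 fun x => 1 * (D f \* g) x + (f \* D g) x}.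
Proof.
move=> /derivable_onP df /derivable_onP dg x xab; rewrite mul1r.
by apply: has_deriv_D => //; exact: has_deriv_mul (df _ xab) (dg _ xab).
Qed.

Lemma Cn_mul m f g : Cn a b (Some m) f -> Cn a b (Some m) g ->
  Cn a b (Some m) (f \* g).
Proof.
elim: m f g => [|m IH] f g; first by rewrite !Cn0; exact: cont_mul.
move=> Cf1 Cg1; have Cf := Cn_pred Cf1; have Cg := Cn_pred Cg1.
move: Cf1 Cg1 => /CnS[/derivable_onP df cf Cf'] /CnS[/derivable_onP dg cg Cg'].
apply: CnS_has_deriv (Cn_lin 1 (IH _ _ Cf' Cg) (IH _ _ Cf Cg')) => [x xab|].
  by rewrite mul1r; exact: has_deriv_mul (df _ xab) (dg _ xab).
exact: cont_mul.
Qed.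

Lemma nderiv_on_lin m c f g : Cn a b (Some m) f -> Cn a b (Some m) g ->
  {in `[a, b], nderiv_on a b m (fun x => c * f x + g x) =1
     fun x => c * nderiv_on a b m f x + nderiv_on a b m g x}.
Proof.
elim: m f g => [|m IH] f g; first by [].
move=> /CnS[/derivable_onP df _ Cf] /CnS[/derivable_onP dg _ Cg] x xab.
rewrite !nderiv_onSr -IH //; apply: nderiv_on_ext xab => y yab.
apply: has_deriv_D => //.
by apply: has_deriv_lin; [exact: df|exact: dg].
Qed.

Lemma nderiv_on_cst j c : (0 < j)%N ->
  {in `[a, b], nderiv_on a b j (cst c) =1 cst 0}.
Proof.
case: j => // j _; rewrite nderiv_onSr.
elim: j c => [|j IH] c x xab.
  by apply: has_deriv_D => //; exact: has_deriv_cst.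
rewrite nderiv_onSr -(IH 0 x xab); apply: nderiv_on_ext xab => y yab.
apply: deriv_on_ext yab => z zab.
by apply: has_deriv_D => //; exact: has_deriv_cst.
Qed.

(** The induction differentiates once: (f g)' = f' g + f g', where f' vanishes to
    order j and f to order j + 1, so both products vanish to order j. *)
Lemma nderiv_on_mul_flat j f g x : x \in `[a, b] ->
  Cn a b (Some j) f -> Cn a b (Some j) g ->
  (forall i, (i <= j)%N -> nderiv_on a b i f x = 0) ->
  nderiv_on a b j (f \* g) x = 0.
Proof.
move=> xab; elim: j f g => [|j IH] f g Cf Cg flat.
  by rewrite /= [f x](flat 0) // mul0r.
have [df _ Cf'] := (CnS _ _).1 Cf; have [dg _ Cg'] := (CnS _ _).1 Cg.
have [{}Cf {}Cg] := (Cn_pred Cf, Cn_pred Cg).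
rewrite nderiv_onSr (nderiv_on_ext _ (deriv_on_mul df dg)) //.
rewrite nderiv_on_lin //; [|exact: Cn_mul|exact: Cn_mul].
rewrite !IH ?mulr0 ?addr0 // => i ij; first exact: flat (leqW ij).
by rewrite -nderiv_onSr; exact: flat.
Qed.

End Derivatives_on_a_segment.

(** * Affine change of variable *)

Section Affine_change_of_variable.
Set Implicit Arguments.
Context {R : realType} {a b : R}.
Hypothesis ab : a < b.
Implicit Types (s : R -> R) (x d : R).
Local Notation lambda := (to_unit a b).

Lemma to_unit_itv x : x \in `[a, b] -> lambda x \in `[0, 1].
Proof.
have ba : 0 < b - a by rewrite subr_gt0.
rewrite !in_itv /= /to_unit => /andP[ax xb].
rewrite divr_ge0 ?subr_ge0 // ?(ltW ab) //=.
by rewrite ler_pdivrMr // mul1r lerD2r.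
Qed.

Lemma to_unit_continuous : continuous lambda.
Proof.
by move=> x; apply: cvgM; [apply: cvgB|]; by [exact: cvg_id|exact: cvg_cst].
Qed.

(** The two difference quotients are proportional, and lambda maps punctured
    neighbourhoods in [a, b] to punctured ones in [0, 1] by injectivity. *)
Lemma has_deriv_to_unit s x d : @has_deriv _ 0 1 s (lambda x) d ->
  @has_deriv _ a b (s \o lambda) x ((b - a)^-1 * d).
Proof.
have ba : b - a != 0 by rewrite subr_eq0 gt_eqF.
move=> ds; rewrite /has_deriv.
rewrite (_ : slope _ x = fun y => (b - a)^-1 * slope s (lambda x) (lambda y)).
  apply: cvgM; first exact: cvg_cst.
  apply: cvg_comp ds => P /=.
  move=> /(to_unit_continuous x).
  apply: (@filterS _ (nbhs x)) => y P' yx yab.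
  apply: (P' _ (to_unit_itv _ yab)).
  apply: contra_neq yx => /(mulIf (invr_neq0 ba)) /(addIr _) //.
apply/funext => y; rewrite /slope /to_unit /= -mulrBl opprB addrA subrK.
by rewrite invf_div [RHS]mulrCA (mulrA (b - a)^-1) mulVf // mul1r.
Qed.

Lemma cont_to_unit s : {within `[0, 1], continuous s} ->
  {within `[a, b], continuous (s \o lambda)}.
Proof.
move=> /subspace_continuousP cs; apply/subspace_continuousP => x xab.
apply: cvg_comp (cs _ (to_unit_itv _ xab)) => P /=.
move=> /(to_unit_continuous x).
apply: (@filterS _ (nbhs x)) => y P' yab.
exact: P' (to_unit_itv _ yab).
Qed.

Lemma Cn_to_unit m s : Cn 0 1 (Some m) s -> Cn a b (Some m) (s \o lambda).
Proof.
elim: m s => [|m IH] s; first by rewrite !Cn0; exact: cont_to_unit.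
move=> /CnS[/derivable_onP ds cs /IH Cs].
apply: (@CnS_has_deriv _ _ _ ab _ _
  (* The zero term gives the derivative the shape c * u + v of Cn_lin *)
  (fun x => (b - a)^-1 * (deriv_on 0 1 s \o lambda) x + cst 0 x)).
- by move=> x xab; rewrite addr0; apply: has_deriv_to_unit; exact/ds/to_unit_itv.
- exact: cont_to_unit.
- by apply: Cn_lin => //; exact: Cn_cst.
Qed.

Lemma nderiv_on_to_unit m s : Cn 0 1 (Some m) s ->
  {in `[a, b], nderiv_on a b m (s \o lambda) =1
    fun x => (b - a) ^- m * nderiv_on 0 1 m s (lambda x)}.
Proof.
elim: m s => [|m IH] s; first by move=> _ x _; rewrite expr0 invr1 mul1r.
move=> /CnS[/derivable_onP ds cs Cs] x xab.
rewrite !nderiv_onSr exprS invfM -mulrA -IH //.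
have nderiv0 : nderiv_on a b m (cst 0) x = 0.
  by case: (m) => // k; rewrite nderiv_on_cst.
rewrite -[RHS]addr0 -[X in _ = _ + X]nderiv0 -nderiv_on_lin //; last 2 first.
- exact: Cn_to_unit.
- exact: Cn_cst.
apply: nderiv_on_ext xab => y yab; rewrite addr0.
by apply: has_deriv_D => //; apply: has_deriv_to_unit; exact/ds/to_unit_itv.
Qed.

End Affine_change_of_variable.

(** * Blending to zero *)

Theorem corollary5 (R : realType) (a b : R) (l n r : enat) (sigma : R -> R)
    (hab : a < b) (hln : enat_le l n) (hrn : enat_le r n)
    (hsigma : smooth_step l r sigma) :
  linear_on_Cn a b n (blend_left a b sigma) /\
  leftward_blend_to_zero a b n l r (blend_left a b sigma).
Proof.
have [[_ _ Csigma] [sigma0 sigma1 flat0 flat1]] := hsigma.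
have {}Csigma m : Cn 0 1 (Some m) sigma.
  by move: Csigma => /Cn_finite; apply.
pose s := sigma \o to_unit a b.
have Cs m : Cn a b (Some m) s by apply: Cn_to_unit.
have nderiv_s m x : x \in `[a, b] ->
    nderiv_on a b m s x = (b - a) ^- m * nderiv_on 0 1 m sigma (to_unit a b x).
  by move=> xab; rewrite nderiv_on_to_unit.
have aab : a \in `[a, b] by rewrite in_itv /= lexx ltW.
have bab : b \in `[a, b] by rewrite in_itv /= lexx ltW.
have to_a : to_unit a b a = 0 by rewrite /to_unit subrr mul0r.
have to_b : to_unit a b b = 1 by rewrite /to_unit divff // subr_eq0 gt_eqF.
split; first by move=> c f g _ _ x _; rewrite /blend_left /=; ring.
split=> //.
  split=> [f /Cn_finite Cf|f g _ _ fg x xab]; last by rewrite /blend_left /= fg.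
  by apply/Cn_finite => m /Cf; exact: Cn_mul.
move=> g /Cn_finite Cg; split=> j jl.
  have jn : fin_le j n.
    case: l jl hln {hsigma flat0} => [l|] /= jl; last by move=> /eqP ->.
    exact: fin_le_trans.
  apply: nderiv_on_mul_flat => //; first exact: Cg.
  move=> [_|i ij]; first by rewrite /= to_a sigma0.
  by rewrite nderiv_s // to_a flat0 ?mulr0 //; exact: fin_le_trans jl.
have jn : fin_le j n.
  case: r jl hrn {hsigma flat1} => [r|] /= jl; last by move=> /eqP ->.
  exact: fin_le_trans.
(* t = s - 1 vanishes to order r at b, and s * g = t * g + g *)
pose t x := 1 * s x + cst (-1) x.
have Ct : Cn a b (Some j) t by apply: Cn_lin => //; exact: Cn_cst.
have -> : blend_left a b sigma g = fun x => 1 * (t \* g) x + g x.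
  by apply/funext => x; rewrite /blend_left /t /s /=; ring.
rewrite nderiv_on_lin //; [|by apply: Cn_mul => //; exact: Cg|exact: Cg].
rewrite nderiv_on_mul_flat ?mulr0 ?add0r //; first exact: Cg.
move=> [_|i ij]; first by rewrite /= /t /s /= to_b sigma1 mul1r subrr.
rewrite nderiv_on_lin //; last exact: Cn_cst.
rewrite nderiv_on_cst // nderiv_s // to_b flat1 ?mulr0 ?addr0 //.
exact: fin_le_trans jl.
Qed.
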